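(* Let $S:[0,1)\to[0,1)$ be an interval translation map with branches $I_1,\dots,I_n$, let $\mu$ be a non-atomic $S$-invariant Borel probability measure, $J=\operatorname{supp}\mu$, and let $T=h\circ S\circ q$ be the induced Lebesgue-preserving interval map in the distribution coordinate $h(x)=\mu([0,x])$. Then the canonical defect cut set $\mathcal C_{\mathrm{def}}$ has the following properties. (i) Let $U$ be a connected component of $[0,1]\setminus\mathcal C_{\mathrm{def}}$. If $U\cap Y\neq\emptyset$, then $q(U\cap Y)$ is contained in a single branch $I_k$, and there is a constant $d_U$ such that $T(u)=u+d_U$ for every $u\in U\cap Y$. In particular, $T$ is a translation on $U$ modulo Lebesgue-null sets. (ii) If $\mathcal C_{\mathrm{def}}$ is finite, then $(J,\mu,S)$ is metrically equivalent to a finite interval exchange transformation. (iii) If $\operatorname{Leb}(\mathcal C_{\mathrm{def}})=0$, then $(J,\mu,S)$ is metrically equivalent to a countable interval exchange transformation.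
   Context: Interval translation map: there are $0=t_0<\dots<t_n=1$ and $c_k\in\mathbb R$ such that, with $I_k=[t_{k-1},t_k)$ (the branches), $S(x)=\tau_k(x):=x+c_k\in[0,1)$ for all $x\in I_k$. $S$-invariance means $\mu(S^{-1}B)=\mu(B)$ for all Borel $B$. The measure $\mu$ is also regarded as a measure on $[0,1]$ with $\mu(\{1\})=0$; $J$ is its closed support in $[0,1]$; $h(x)=\mu([0,x])$, $x\in[0,1]$. The system $(J,\mu,S)$ is understood modulo $\mu$-null sets. Induced map. Fix a Borel set $X_0\subset J$ with $\mu(X_0)=1$, $S(X_0)=X_0$, such that $S:X_0\to X_0$ is a measurable bijection with measurable, measure-preserving inverse (such a set always exists in this setting). Let $E_0$ be the countable set consisting of $t_0,\dots,t_n$ and of all endpoints of connected components of $[0,1]\setminus J$, and put $X=X_0\setminus\bigcup_{m\in\mathbb Z}S^m(E_0\cap X_0)$, where $S^m$ refers to the bijection $S:X_0\to X_0$. Then $h$ is injective on $X$, $Y=h(X)$ has full Lebesgue measure, and $q:Y\to X$ denotes the inverse of $h:X\to Y$. Define $T(u)=h(S(q(u)))$ for $u\in Y$ and $T(u)=u_*$, a fixed point of $[0,1]$, for $u\notin Y$. Canonical defect cut set. For Borel $B\subset I_k$ put $\sigma_k(B)=\mu(\tau_k(B))-\mu(B)$; this is a finite positive Borel measure on $I_k$. For Borel $E\subset[0,1]$ put $\rho_k(E)=\sigma_k(h^{-1}(E)\cap I_k)$. Then $\mathcal C_{\mathrm{def}}=\{h(t_0),\dots,h(t_n)\}\cup\bigcup_{k=1}^n\operatorname{supp}\rho_k$.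 A (finite) interval exchange transformation (IET) is an interval translation map that is one-to-one except possibly at branch endpoints; equivalently the images of its branches are pairwise disjoint modulo Lebesgue-null sets and cover the interval modulo endpoints. A countable IET is a measurable map $R:[0,1]\to[0,1]$ for which there is a countable family of pairwise disjoint open intervals $U_m$ whose union has full Lebesgue measure, and constants $d_m$, such that $R(u)=u+d_m$ for a.e. $u\in U_m$, while the intervals $U_m+d_m$ are contained in $[0,1]$ up to endpoints, are pairwise disjoint modulo endpoints, and cover $[0,1]$ modulo a null set. IETs carry Lebesgue measure. Metric equivalence: systems $(X,\mu,S)$ and $(Y,\nu,T)$ on standard Borel probability spaces are metrically equivalent if there are invariant full-measure sets $X'\subset X$, $Y'\subset Y$ and a measurable bijection $\Phi:X'\to Y'$ with measurable inverse, $\Phi_*\mu=\nu$ and $\Phi\circ S=T\circ\Phi$ on $X'$. *)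

(* Defs.v *)
From HB Require Import structures.
From mathcomp Require Import all_boot all_order all_algebra.
From mathcomp Require Import all_classical all_reals all_analysis.
Set Implicit Arguments.
Unset Strict Implicit.
Unset Printing Implicit Defensive.
Import Order.TTheory GRing.Theory Num.Theory.
Import numFieldNormedType.Exports.
Local Open Scope classical_set_scope.
Local Open Scope ring_scope.

(* Self-maps of [0,1) and [0,1] are total functions R -> R; their values off
   the domain are irrelevant, and preimages under them are intersected with
   the domain. *)

(* The inverse of the bijection f : A -> f(A) (junk value 0 off f(A)). *)
Definition inverse_on (R : realType) (A : set R) (f : R -> R) : R -> R :=
  'pinv_(fun=> 0) A f.

(* The branches I_k are numbered from 0. *)
Definition branch (R : realType) (n : nat) (t : 'I_n.+1 -> R) (k : 'I_n) :
    set R :=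
  `[t (widen_ord (leqnSn n) k), t (lift ord0 k)[%classic.

Definition interval_translation_map (R : realType) (n : nat)
    (t : 'I_n.+1 -> R) (c : 'I_n -> R) (S : R -> R) : Prop :=
  [/\ t ord0 = 0, t ord_max = 1,
      forall k : 'I_n, t (widen_ord (leqnSn n) k) < t (lift ord0 k) &
      forall (k : 'I_n) (x : R), branch t k x ->
        S x = x + c k /\ 0 <= x + c k < 1].

Definition invariant_measure (R : realType) (S : R -> R)
    (mu : set (measurableTypeR R) -> \bar R) : Prop :=
  forall B : set (measurableTypeR R), measurable B ->
    mu (`[0, 1[ `&` S @^-1` B) = mu B.

Definition nonatomic (R : realType)
    (mu : set (measurableTypeR R) -> \bar R) : Prop :=
  forall A : set (measurableTypeR R), measurable A -> (0 < mu A)%E ->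
    exists B : set (measurableTypeR R),
      [/\ measurable B, B `<=` A & (0 < mu B < mu A)%E].

(* Closed support in [0,1]. *)
Definition supp (R : realType) (nu : set R -> \bar R) : set R :=
  [set x | `[0, 1]%classic x /\
     forall V : set R, open V -> V x -> (0 < nu (V `&` `[0%R, 1%R]%classic))%E].

Definition is_component (R : realType) (A U : set R) : Prop :=
  exists2 x, A x & U = connected_component A x.

Section induced_system.
Variables (R : realType) (n : nat) (t : 'I_n.+1 -> R) (c : 'I_n -> R).
Variables (S : R -> R) (mu : set R -> \bar R).

Definition distr (x : R) : R := fine (mu `[0, x]).

(* X0 is required to avoid 1, where S is not defined. *)
Definition invertible_core (X0 : set (measurableTypeR R)) : Prop :=
  [/\ measurable X0, X0 `<=` supp mu `&` `[0, 1[ & mu X0 = 1%E] /\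
  [/\ set_bij X0 X0 S,
      measurable_fun X0 (S : measurableTypeR R -> measurableTypeR R),
      measurable_fun X0
        (inverse_on X0 S : measurableTypeR R -> measurableTypeR R) &
      forall B : set (measurableTypeR R), measurable B -> B `<=` X0 ->
        mu (X0 `&` inverse_on X0 S @^-1` B) = mu B].

Definition exceptional_points : set R :=
  range t `|`
  [set e | exists2 V, is_component (`[0, 1] `\` supp mu) V &
                      e = inf V \/ e = sup V].

Definition iterz (X0 : set R) (m : int) : R -> R :=
  match m with
  | Posz p => iter p S
  | Negz p => iter p.+1 (inverse_on X0 S)
  end.

Definition good_points (X0 : set R) : set R :=
  X0 `\` \bigcup_(m in [set: int])
           (iterz X0 m @` (exceptional_points `&` X0)).

Definition good_values (X0 : set R) : set R := distr @` good_points X0.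

Definition quantile (X0 : set R) : R -> R :=
  inverse_on (good_points X0) distr.

Definition induced_map (X0 : set R) (ustar u : R) : R :=
  if u \in good_values X0 then distr (S (quantile X0 u)) else ustar.

Definition defect (k : 'I_n) (B : set R) : \bar R :=
  (mu [set (x + c k)%R | x in B] - mu B)%E.

Definition defect_distr (k : 'I_n) (E : set R) : \bar R :=
  defect k (distr @^-1` E `&` branch t k).

Definition defect_cut_set : set R :=
  distr @` range t `|` \bigcup_(k in [set: 'I_n]) supp (defect_distr k).

End induced_system.

Definition finite_iet (R : realType) (F : R -> R) : Prop :=
  exists (n : nat) (t : 'I_n.+1 -> R) (c : 'I_n -> R),
    interval_translation_map t c F /\ set_inj (`[0, 1[ `\` range t) F.

(* A family of open intervals indexed by a set D of natural numbers; for open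
   intervals, inclusion and disjointness up to endpoints are plain inclusion
   and disjointness. *)
Definition countable_iet (R : realType) (F : R -> R) : Prop :=
  [/\ measurable_fun (`[0, 1]%classic : set (measurableTypeR R))
        (F : measurableTypeR R -> measurableTypeR R),
      set_fun `[0, 1] `[0, 1] F &
      exists (D : set nat) (a b d : nat -> R),
        let U m : set R := `]a m, b m[%classic in
        let V m : set R := `]a m + d m, b m + d m[%classic in
        [/\ forall m, D m -> a m < b m /\ U m `<=` `[0, 1],
            trivIset D U,
            lebesgue_measure (`[0, 1] `\` \bigcup_(m in D) U m) = 0%E &
            forall m, D m ->
              {ae lebesgue_measure, forall u, U m u -> F u = u + d m}] /\
        [/\ forall m, D m -> V m `<=` `[0, 1],
            trivIset D V &
            lebesgue_measure (`[0, 1] `\` \bigcup_(m in D) V m) = 0%E]].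

(* The systems live on Borel subsets A, B of R.  Invariance of the full-measure
   sets is forward invariance, S(X') included in X'. *)
Definition metrically_equivalent (R : realType)
    (A : set (measurableTypeR R)) (mu : set (measurableTypeR R) -> \bar R)
    (S : R -> R)
    (B : set (measurableTypeR R)) (nu : set (measurableTypeR R) -> \bar R)
    (T : R -> R) : Prop :=
  exists (X' Y' : set (measurableTypeR R)) (Phi : R -> R),
    [/\ [/\ measurable X', X' `<=` A, mu (A `\` X') = 0%E & set_fun X' X' S],
        [/\ measurable Y', Y' `<=` B, nu (B `\` Y') = 0%E & set_fun Y' Y' T],
        [/\ set_bij X' Y' Phi,
            measurable_fun X' (Phi : measurableTypeR R -> measurableTypeR R) &
            measurable_fun Y'
              (inverse_on X' Phi : measurableTypeR R -> measurableTypeR R)],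
        (forall E : set (measurableTypeR R), measurable E -> E `<=` Y' ->
           mu (X' `&` Phi @^-1` E) = nu E) &
        forall x, X' x -> Phi (S x) = T (Phi x)].

(* Main.v *)
Require Import Defs.
From HB Require Import structures.
From mathcomp Require Import all_boot all_order all_algebra.
From mathcomp Require Import all_classical all_reals all_analysis.
From mathcomp Require Import measurable_realfun ring lra.
Import Order.TTheory GRing.Theory Num.Theory.
Import numFieldNormedType.Exports.
Local Open Scope classical_set_scope.
Local Open Scope ring_scope.

(* Since [mu] has no atoms, [h] is continuous, its generalized inverse [Q]
   pushes Lebesgue measure on ]0, 1] to [mu], and the fibre of [h] through a
   good point is a singleton; hence [q = Q] on [Y], and [h] is an isomorphism
   from [(X, mu, S)] onto [(Y, Leb, T)].  Over an interval avoiding the cut set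
   only one branch is involved, and there the vanishing of the defect makes
   [h (x + c k) - h x] locally constant, so that [T] is a translation.  As [T]
   is injective on [Y], which is conull, distinct pieces have disjoint
   translates.  In case (iii) the countable exchange is [T] itself.  In case
   (ii) the finite exchange is defined everywhere by the translations; it agrees
   with [T] off the finite cut set, whose countably many preimages under the
   iterates of [S] are discarded. *)

(** * Supports, connected components and translations of the line *)

Lemma closed_supp (R : realType) (nu : set R -> \bar R) : closed (supp nu).
Proof.
rewrite closedE => x nx.
have x01 : `[0, 1]%classic x.
  apply: contrapT => nx01; apply: nx.
  have : open (~` (`[0, 1]%classic : set R)).
    by rewrite openC; exact: interval_closed.
  rewrite openE => /(_ x nx01); by apply: filterS => y ny [].
split=> // V oV Vx; rewrite ltNge; apply/negP => V0; apply: nx.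
have : nbhs x V by apply: open_nbhs_nbhs; split.
apply: filterS => y Vy [_ /(_ V oV Vy)]; by rewrite ltNge V0.
Qed.

Lemma component_is_interval (R : realType) (A U : set R) :
  is_component A U -> is_interval U.
Proof. by move=> [x _ ->]; apply/connected_intervalP/component_connected. Qed.

Lemma component_subset (R : realType) (A U : set R) :
  is_component A U -> U `<=` A.
Proof. by move=> [x _ ->]; exact: connected_component_sub. Qed.

Lemma is_interval_connected_component (R : realType) (A B : set R) (x : R) :
  is_interval B -> B x -> B `<=` A -> B `<=` connected_component A x.
Proof.
by move=> /connected_intervalP cB Bx BA; exact: connected_component_max.
Qed.

(** Since [C] is closed, a point of a component has around it a nondegenerate interval, relative to
    [0, 1], that misses [C] and so stays in the component. That interval contains a rational, and
    the rationals then index the components. *)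
Lemma countable_components (R : realType) (C : set R) : closed C ->
  countable [set V | is_component (`[0, 1] `\` C) V].
Proof.
move=> cC; set A := `[0, 1] `\` C.
suff sub : [set V | is_component A V] `<=`
    (fun r : rat => connected_component A (ratr r)) @` setT.
  apply: sub_countable (subset_card_le sub) _.
  apply: sub_countable (card_image_le _ _) _.
  exact: countableP.
move=> _ [x [x01 nCx] ->].
have : nbhs x (~` C).
  by apply: open_nbhs_nbhs; split=> //; rewrite openC.
move=> /nbhs_ballP[e /= e0 xe].
have x01' : 0 <= x <= 1 by move: x01; rewrite /= in_itv.
have [r] : exists r : rat, ratr r \in `]Num.max 0 (x - e), Num.min 1 (x + e)[.
  have [|r rp] := @rat_in_itvoo R (Num.max 0 (x - e)) (Num.min 1 (x + e)).
    rewrite lt_min !gt_max; lra.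
  by exists r.
rewrite in_itv /= gt_max lt_min => /andP[/andP[r0 r1] /andP[r2 r3]].
exists r => //; apply/esym/same_connected_component.
pose B := `[0, 1] `&` `]x - e, x + e[ : set R.
apply: (is_interval_connected_component _ _ B) => //.
- move=> a b [] /= + + [] /= + + z /andP[az zb].
  rewrite /B /= !in_itv /=; lra.
- by rewrite /B /= !in_itv /=; lra.
- move=> z [] /= z01; rewrite in_itv /= => ze; split=> //.
  by apply: xe; rewrite /ball /= ltr_norml; lra.
- by rewrite /B /= !in_itv /=; lra.
Qed.

Lemma measurable_fun_shift (R : realType) (e : R) :
  measurable_fun setT ((fun x => x + e) : measurableTypeR R -> measurableTypeR R).
Proof. by apply: nondecreasing_measurable => // x y xy; rewrite lerD2r. Qed.

(** The pushforward of Lebesgue measure along the translation has the right values on half-open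
    intervals, and these determine the measure. *)
Lemma lebesgue_measure_shift (R : realType) (e : R)
    (A : set (measurableTypeR R)) : measurable A ->
  lebesgue_measure [set x | A (x + e)] = lebesgue_measure A.
Proof.
move=> mA.
have mf := measurable_fun_shift _ e.
rewrite -[LHS]/(pushforward lebesgue_measure
  ((fun x => x + e) : measurableTypeR R -> measurableTypeR R) A).
apply/esym/lebesgue_measure_unique => //= _ [[a b] /= _ <-].
rewrite /pushforward.
have -> : (fun x : measurableTypeR R => x + e) @^-1` `]a, b]%classic =
   `]a - e, b - e]%classic.
  by apply/seteqP; split => x /=; rewrite !in_itv /=; lra.
rewrite !lebesgue_measure_itv /= !lte_fin ltrD2r; case: ifP => // _.
by rewrite -!EFinD; congr EFin; lra.
Qed.

Lemma inverse_onK (R : realType) (A : set R) (f : R -> R) (x : R) :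
  {in A &, injective f} -> A x -> inverse_on A f (f x) = x.
Proof. by move=> fI Ax; rewrite /inverse_on pinvKV// inE. Qed.

Lemma image_shift (R : realType) (B : set R) (e : R) :
  [set x + e | x in B] = (fun x => x - e) @^-1` B.
Proof.
apply/seteqP; split=> [_ [x Bx <-]|x Bx]; first by rewrite /preimage /= addrK.
by exists (x - e) => //; rewrite subrK.
Qed.

Lemma measurable_image_shift (R : realType) (B : set (measurableTypeR R)) (e : R) :
  measurable B -> measurable ([set x + e | x in B] : set (measurableTypeR R)).
Proof.
move=> mB; rewrite image_shift -[X in measurable X]setTI.
exact: measurable_fun_shift.
Qed.

Lemma lebesgue_measure_unitC (R : realType) (W : set (measurableTypeR R)) :
  measurable W -> W `<=` `[0, 1] ->
  lebesgue_measure (`[0, 1] `\` W) = 0%E <-> lebesgue_measure W = 1%E.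
Proof.
move=> mW W01; have l01 : lebesgue_measure (`[0, 1]%classic : set R) = 1%E.
  by rewrite lebesgue_measure_itv /= lte01 oppr0 adde0.
have -> : lebesgue_measure (`[0, 1] `\` W) = (1 - lebesgue_measure W)%E.
  rewrite measureD//; last by rewrite [X in (X < _)%E]l01 ltry.
  by rewrite setIidr// [X in (X - _)%E]l01.
have Woo : lebesgue_measure W \is a fin_num.
  rewrite ge0_fin_numE//; apply: (@le_lt_trans _ _ 1%E); last exact: ltry.
  by rewrite -l01; apply: le_measure; rewrite ?inE.
rewrite -(fineK Woo) -EFinB; split=> -[W1]; congr EFin; last by rewrite W1 subrr.
by move: W1; lra.
Qed.

(** * Subdivisions of the unit interval *)

Section branches.
Variables (R : realType) (n : nat) (t : 'I_n.+1 -> R).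
Hypothesis t_incr :
  forall k : 'I_n, t (widen_ord (leqnSn n) k) < t (lift ord0 k).

Lemma knots_nondecreasing (i j : 'I_n.+1) : (i <= j)%N -> t i <= t j.
Proof.
have H : forall (m : nat) (i j : 'I_n.+1), (j = i + m :> nat)%N -> t i <= t j.
  elim=> [|m IH] i' j' jE.
    by rewrite (_ : j' = i')//; apply: val_inj; rewrite /= jE addn0.
  have lem : (i' + m < n)%N by rewrite -ltnS -addnS -jE ltn_ord.
  apply: le_trans (IH i' (widen_ord (leqnSn n) (Ordinal lem)) _) _ => //.
  rewrite (_ : j' = lift ord0 (Ordinal lem)) ?(ltW (t_incr _))//.
  by apply: val_inj => /=; rewrite jE addnS.
by move=> ij; apply: (H (j - i)%N); rewrite subnKC.
Qed.

(** The branch starts at the last knot not beyond [x]; the strict upper bound on [x] keeps the index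
    of that knot below [n]. *)
Lemma branch_exists (x : R) : t ord0 <= x < t ord_max ->
  exists k, branch t k x.
Proof.
move=> /andP[x0 x1].
pose P (k : 'I_n.+1) := t k <= x.
case: (@arg_maxnP _ ord0 P (fun k => nat_of_ord k) x0) => i Pi imax.
have ltin : (i < n)%N.
  rewrite ltn_neqAle -ltnS ltn_ord andbT; apply/eqP => iE.
  have : t ord_max <= x by rewrite (_ : ord_max = i)//; exact: val_inj.
  by rewrite leNgt x1.
exists (Ordinal ltin); rewrite /branch /= in_itv /=; apply/andP; split.
  by rewrite (_ : widen_ord _ _ = i)//; exact: val_inj.
rewrite ltNge; apply/negP => /imax /=.
by rewrite /bump /= add1n ltnn.
Qed.

Lemma branch_uniq (x : R) (k l : 'I_n) : branch t k x -> branch t l x -> k = l.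
Proof.
wlog: k l / (k <= l)%N.
  move=> H kx lx; case: (leqP k l) => kl; first exact: H.
  by apply/esym/H => //; exact: ltnW.
rewrite leq_eqVlt => /orP[/eqP kl _ _|kl]; first exact: val_inj.
rewrite /branch /= !in_itv /= => /andP[_ xk] /andP[lx _].
have := knots_nondecreasing (lift ord0 k) (widen_ord (leqnSn n) l).
by rewrite /= /bump add1n => /(_ kl); rewrite leNgt (le_lt_trans lx xk).
Qed.

Lemma open_branch_knots (k : 'I_n) (x : R) :
  t (widen_ord (leqnSn n) k) < x < t (lift ord0 k) -> ~ range t x.
Proof.
move=> /andP[kx xk] [j _ jx]; case: (leqP j k) => jk.
  have := knots_nondecreasing j (widen_ord (leqnSn n) k).
  by move=> /(_ jk); rewrite jx leNgt kx.
have := knots_nondecreasing (lift ord0 k) j.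
by rewrite /= /bump add1n => /(_ jk); rewrite jx leNgt xk.
Qed.

End branches.

(** This turns a finite cut set into the knots of an exchange, by sorting its points without
    repetition. Lying in [0, 1] and containing 0 and 1 fixes the extreme knots. *)
Lemma finite_subdivision (R : realType) (C : set R) : finite_set C ->
  C `<=` `[0, 1] -> C 0 -> C 1 ->
  exists (m : nat) (s : 'I_m.+1 -> R), [/\ s ord0 = 0, s ord_max = 1,
    forall k : 'I_m, s (widen_ord (leqnSn m) k) < s (lift ord0 k) &
    range s = C].
Proof.
move=> /finite_seqP[l0 ->] C01 C0 C1; pose l := sort <=%O (undup l0).
have lE x : (x \in l) = (x \in l0) by rewrite mem_sort mem_undup.
have l_lt : sorted <%O l by rewrite sort_lt_sorted undup_uniq.
have [m lm] : exists m, size l = m.+1.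
  have : 0 \in l by rewrite lE.
  by case: (l) => // x l' _; exists (size l').
have l01 i : (i < m.+1)%N -> 0 <= l`_i <= 1.
  move=> im; have /C01 : l`_i \in l0 by rewrite -lE mem_nth// lm.
  by rewrite /= in_itv.
have l_le i j : (i <= j < m.+1)%N -> l`_i <= l`_j.
  move=> /andP[ij jm]; rewrite lt_sorted_leq_nth// inE lm//.
  exact: leq_ltn_trans jm.
exists m, (fun i => l`_i); split.
- apply/eqP; rewrite eq_le; have /andP[-> _] := l01 0%N isT; rewrite andbT.
  have l0' : 0 \in l by rewrite lE.
  by rewrite -[leRHS](nth_index 0 l0') l_le//= -lm index_mem.
- apply/eqP; rewrite eq_le; have /andP[_ ->] := l01 m (ltnSn m).
  have l1' : 1 \in l by rewrite lE.
  rewrite -[leLHS](nth_index 0 l1') l_le//= ltnSn andbT -ltnS -lm.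
  by rewrite index_mem.
- move=> k; rewrite lt_sorted_ltn_nth// inE lm /= /bump ?add1n ltnS //.
  exact: ltnW.
- apply/seteqP; split=> [_ [i _ <-]|x xl] /=; first by rewrite -lE mem_nth// lm.
  have xl' : x \in l by rewrite lE.
  have xm : (index x l < m.+1)%N by rewrite -lm index_mem.
  by exists (Ordinal xm) => //=; rewrite nth_index.
Qed.

(** * The distribution function and its generalized inverse *)

(* The truncation [Num.min u 1] makes this a total nondecreasing function. *)
Definition generalized_inverse {R : realType} (mu : set R -> \bar R) (u : R) : R :=
  inf [set x | 0 <= x /\ Num.min u 1 <= distr mu x].

Section distribution_function.
Variables (R : realType) (mu : probability (measurableTypeR R) R).
Hypothesis mu01 : mu `[0, 1[%classic = 1%E.

Local Notation h := (distr mu).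
Local Notation Q := (generalized_inverse mu).
Local Notation leb := (@lebesgue_measure R).

Lemma probability_eq0S (A B : set (measurableTypeR R)) :
  measurable A -> measurable B -> A `<=` B -> mu B = 0%E -> mu A = 0%E.
Proof.
move=> mA mB AB B0; apply/eqP; rewrite -measure_le0 -B0.
by apply: le_measure => //; rewrite inE.
Qed.

Lemma probability_setI1 (A B : set (measurableTypeR R)) :
  measurable A -> measurable B -> mu B = 1%E -> mu (A `&` B) = mu A.
Proof.
move=> mA mB B1; have BC0 : mu (~` B) = 0%E.
  by rewrite probability_setC// B1 subee.
have mBC : measurable (~` B) by exact: measurableC.
have mAB : measurable (A `\` B) by exact: measurableD.
rewrite -[in RHS](setUIDK A B) measureU//; last 2 first.
- exact: measurableI.
- by rewrite setDE setIACA setICr setI0.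
rewrite [X in _ = (_ + X)%E](_ : _ = 0%E) ?adde0//.
by apply: (probability_eq0S _ (~` B)) => // x [].
Qed.

(** As [mu] is carried by [[0, 1[], cutting the half-line at 0 loses no mass; [h] thus behaves as a
    cumulative distribution function on the whole line. *)
Lemma distrE (x : R) : (h x)%:E = mu `]-oo, x]%classic.
Proof.
rewrite /distr fineK ?fin_num_measure//.
rewrite -(probability_setI1 `]-oo, x]%classic `[0, 1[%classic)//.
rewrite -(probability_setI1 `[0, x]%classic `[0, 1[%classic)//.
by congr (mu _); apply/seteqP; split=> y /=; rewrite !in_itv /=; lra.
Qed.

Lemma distr_sub (x y : R) : x <= y -> (h y - h x)%:E = mu `]x, y]%classic.
Proof.
move=> xy.
have -> : `]x, y]%classic = `]-oo, y] `\` `]-oo, x].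
  by apply/seteqP; split=> z /=; rewrite !in_itv /=; lra.
rewrite EFinB !distrE measureD//; last by rewrite ltey_eq fin_num_measure.
by rewrite setIidr// => z /=; rewrite !in_itv /=; lra.
Qed.

Lemma distr_nondecreasing : nondecreasing_fun h.
Proof.
by move=> x y xy; rewrite -subr_ge0 -lee_fin distr_sub.
Qed.

Lemma distr1 : h 1 = 1.
Proof.
apply: EFin_inj; rewrite distrE; apply/eqP; rewrite eq_le probability_le1//=.
by rewrite -mu01; apply: le_measure; rewrite ?inE// => z /=; rewrite !in_itv/=; lra.
Qed.

Hypothesis mu_nonatomic : nonatomic mu.

(** A subset of a singleton is empty or everything, so its measure cannot lie strictly between 0 and
    that of the singleton. *)
Lemma nonatomic_set1 (x : R) : mu [set x] = 0%E.
Proof.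
apply: contrapT => /eqP mux.
have mux0 : (0 < mu [set x])%E by rewrite lt0e mux measure_ge0.
have [B [_ Bx]] := mu_nonatomic _ (measurable_set1 x) mux0.
by have [->|->] := subset_set1 Bx; rewrite ?measure0 ltxx ?andbF.
Qed.

Lemma nonatomic_countable (A : set (measurableTypeR R)) :
  countable A -> measurable A /\ mu A = 0%E.
Proof.
move=> cA; have mA : measurable A by exact: countable_measurable.
split=> //.
have [->|/set0P[a0 Aa0]] := eqVneq A set0; first exact: measure0.
have /pfcard_geP[A0|[f]] := cA; first by rewrite A0 measure0.
have AE : A = \bigcup_i [set f i].
  apply/seteqP; split=> x.
    by move=> /(@surj _ _ _ _ f)[i _ <-]; exists i.
  by move=> [i _ ->]; exact: funS.
apply/negligibleP => //; rewrite AE; apply: negligible_bigcup => i.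
by apply/negligibleP => //; exact: nonatomic_set1.
Qed.

Lemma distr_le0 (x : R) : x <= 0 -> h x = 0.
Proof.
move=> x0; apply/eqP; rewrite eq_le; apply/andP; split; last first.
  by rewrite fine_ge0.
apply: le_trans (distr_nondecreasing _ _ x0) _.
by rewrite /distr set_itv1 nonatomic_set1.
Qed.

Lemma distr_ge0 (x : R) : 0 <= h x.
Proof. by rewrite fine_ge0. Qed.

Lemma distr_le1 (x : R) : h x <= 1.
Proof. by rewrite -lee_fin distrE probability_le1. Qed.

(** The intervals []x - d k, x + d k]] shrink to a null singleton, so their measures tend to 0; by
    monotonicity these measures bound the oscillation of [h] near [x]. *)
Lemma distr_continuous : continuous h.
Proof.
move=> x; apply/cvgrPdist_lt => e e0.
(* The radii are [1 / (k + 1)]; only these three properties of them matter below. *)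
have [d [d0 d_le d_lt]] : exists d : nat -> R, [/\ forall k, 0 < d k,
    forall i j, (i <= j)%N -> d j <= d i & forall r, 0 < r -> exists k, d k < r].
  exists (fun k => k.+1%:R^-1); split=> [//|i j ij|r r0].
    by rewrite lef_pV2 ?posrE// ler_nat.
  exists (Num.truncn r^-1).
  by rewrite invf_plt ?posrE//; exact: truncnS_gt.
pose F (k : nat) : set (measurableTypeR R) := `]x - d k, x + d k]%classic.
have FE : \bigcap_k F k = [set x].
  apply/seteqP; split => [y /= Fy|_ -> k _]; last first.
    have := d0 k; rewrite /F /= in_itv /=; lra.
  apply/eqP; rewrite eq_sym -subr_eq0 -normr_eq0 eq_le normr_ge0 andbT leNgt.
  apply/negP => /d_lt[k dk]; have := Fy k I; rewrite /F /= in_itv /= => yk.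
  by move: dk; rewrite ltNge ler_norml; lra.
have : mu \o F @ \oo --> mu [set x].
  rewrite -FE; apply: nonincreasing_cvg_mu => //.
  - rewrite -ge0_fin_numE// fin_num_measure//; exact: measurable_itv.
  - by move=> i; exact: measurable_itv.
  - by rewrite FE; exact: measurable_set1.
  - move=> i j /d_le dji; apply/subsetPset => y; rewrite /F /= !in_itv /=.
    move: dji; lra.
rewrite nonatomic_set1 => /fine_cvg /cvgrPdist_lt /(_ _ e0)[k _ /(_ k (leqnn k))].
rewrite /= sub0r normrN ger0_norm ?fine_ge0// => Fke.
near=> y.
have yk : `|x - y| < d k by near: y; apply: cvgr_dist_lt.
have dk0 := d0 k.
have : h (x + d k) - h (x - d k) < e.
  rewrite -lte_fin distr_sub; last by move: dk0; lra.
  by rewrite -[X in (X < _)%E]fineK ?fin_num_measure// lte_fin.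
move: yk; rewrite !ltr_norml => yk.
have H1 : h (x - d k) <= h y by apply: distr_nondecreasing; move: yk; lra.
have H2 : h (x - d k) <= h x by apply: distr_nondecreasing; move: dk0; lra.
have H3 : h y <= h (x + d k) by apply: distr_nondecreasing; move: yk; lra.
have H4 : h x <= h (x + d k) by apply: distr_nondecreasing; move: dk0; lra.
move: H1 H2 H3 H4; lra.
Unshelve. all: by end_near. Qed.

Let Q_lb (u : R) : has_lbound [set x | 0 <= x /\ Num.min u 1 <= h x].
Proof. by exists 0 => x []. Qed.

Let Q_ne (u : R) : [set x | 0 <= x /\ Num.min u 1 <= h x] !=set0.
Proof. by exists 1 => /=; rewrite distr1 ge_min lexx orbT. Qed.

Lemma generalized_inverse_itv (u : R) : 0 <= Q u <= 1.
Proof.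
apply/andP; split; first by apply: lb_le_inf => // x [].
by apply: ge_inf => //=; rewrite distr1 ge_min lexx orbT.
Qed.

Lemma generalized_inverse_nondecreasing : nondecreasing_fun Q.
Proof.
move=> u v uv; apply: lb_le_inf => // x [x0 vx].
apply: ge_inf => //=; split=> //; apply: le_trans vx.
by rewrite le_min !ge_min uv lexx orbT.
Qed.

Lemma measurable_generalized_inverse :
  measurable_fun setT (Q : measurableTypeR R -> measurableTypeR R).
Proof.
by apply: nondecreasing_measurable => //; exact: generalized_inverse_nondecreasing.
Qed.

(** If [h (Q u) < u], continuity keeps [h] below [u] up to [Q u + e / 2], which is then a lower
    bound exceeding the infimum [Q u]. *)
Lemma le_distr_generalized_inverse (u : R) : u <= 1 -> u <= h (Q u).
Proof.
move=> u1; rewrite leNgt; apply/negP => hu.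
have /cvgrPdist_lt/(_ (u - h (Q u))) := distr_continuous (Q u).
rewrite subr_gt0 => /(_ hu) /nbhs_ballP[e /= e0 Qe].
have : `|h (Q u) - h (Q u + e / 2)| < u - h (Q u).
  by apply: Qe; rewrite /ball /= ltr_norml; move: e0; lra.
rewrite ltr_norml => /andP[hue _].
suff : Q u + e / 2 <= Q u by move: e0; lra.
apply: lb_le_inf => // x [x0]; rewrite (min_l u1) => ux.
rewrite leNgt; apply/negP => /ltW /distr_nondecreasing.
by move: ux hue; lra.
Qed.

(** This is the Galois connection between [Q] and [h]; it rests on the infimum defining [Q u] being
    attained. *)
Lemma generalized_inverse_le (u x : R) : u <= 1 -> 0 <= x ->
  (Q u <= x) = (u <= h x).
Proof.
move=> u1 x0; apply/idP/idP => [Qx|ux].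
  apply: le_trans (le_distr_generalized_inverse _ u1) _.
  exact: distr_nondecreasing.
by apply: ge_inf => //=; rewrite min_l.
Qed.

Lemma distr_surj (u : R) : 0 <= u <= 1 -> exists2 x, 0 <= x <= 1 & h x = u.
Proof.
move=> u01; have [//|||x] := @IVT R h 0 1 u.
- by apply: continuous_subspaceT; exact: distr_continuous.
- by rewrite distr1 distr_le0// min_l// max_r.
- by rewrite in_itv /= => x01 xu; exists x.
Qed.

Lemma distr_generalized_inverse (u : R) : 0 <= u <= 1 -> h (Q u) = u.
Proof.
move=> u01; have /andP[u0 u1] := u01.
apply/eqP; rewrite eq_le le_distr_generalized_inverse// andbT.
have [x /andP[x0 _] xu] := distr_surj _ u01.
rewrite -[leRHS]xu; apply: distr_nondecreasing.
by rewrite generalized_inverse_le// xu.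
Qed.

(** Two measures that are finite and equal on the rays []x, +oo[], a generating class stable under
    intersection, coincide. On such a ray the Galois connection identifies the preimage under [Q]
    with []h x, 1]]. *)
Lemma lebesgue_measure_generalized_inverse (B : set (measurableTypeR R)) :
  measurable B -> leb (`]0, 1] `&` Q @^-1` B) = mu B.
Proof.
move=> mB; have mI : measurable (`]0, 1]%classic : set (measurableTypeR R)).
  exact: measurable_itv.
rewrite setIC -[LHS]/(pushforward (mrestr leb mI)
  (Q : measurableTypeR R -> measurableTypeR R) B).
have mQ := measurable_generalized_inverse.
pose nu : {measure set (measurableTypeR R) -> \bar R} :=
  measure_function_pushforward__canonical__measure_function_Measure (mrestr leb mI) mQ.
rewrite -[LHS]/(nu B).
apply: (@measure_unique _ R (measurableTypeR R) (@RGenOInfty.G R)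
  (fun k => `](- k%:R : R), +oo[%classic) _ _ _ _ nu mu).
- exact: RGenOInfty.measurableE.
- move=> _ _ [x ->] [y ->]; exists (Num.max x y).
  by apply/seteqP; split=> z /=; rewrite !in_itv /= !andbT gt_max => /andP.
- by move=> k; exists (- k%:R).
- apply/seteqP; split=> // x _; exists (Num.truncn `|x|).+1 => //=.
  rewrite in_itv /= andbT ltrNl; apply: le_lt_trans (truncnS_gt `|x|).
  by rewrite -normrN ler_norm.
- move=> _ [x ->].
  transitivity (1 - (h x)%:E)%E; last first.
    rewrite distrE -(probability_setC mu (measurable_itv `]-oo, x])).
    by congr (mu _); rewrite setCitvl.
  rewrite -[LHS]/(leb _).
  rewrite (_ : _ `&` _ = `]h x, 1]%classic).
    by rewrite lebesgue_measure_itv /= lte_fin lt_neqAle distr_le1 andbT;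
      case: eqP => [->|_] //; rewrite subee.
  (* The Galois connection requires [0 <= x]; for negative [x] it is replaced by [h x = 0] and
     [0 <= Q u]. *)
  apply/seteqP; split=> u /=.
    rewrite !in_itv /= !andbT => -[xQ /andP[u0 u1]]; rewrite u1 andbT.
    rewrite ltNge; apply/negP => uh.
    have [x0|/ltW x0] := leP 0 x; last first.
      by move: uh; rewrite distr_le0//; move: u0; lra.
    by move: xQ; rewrite ltNge generalized_inverse_le// uh.
  rewrite !in_itv /= !andbT => /andP[hu u1]; rewrite u1 (le_lt_trans (distr_ge0 x) hu).
  split=> //; have [x0|x0] := leP 0 x.
    by rewrite ltNge generalized_inverse_le// -ltNge.
  by apply: lt_le_trans x0 _; have /andP[] := generalized_inverse_itv u.
- move=> k; rewrite -[X in (X < _)%E]/(leb _).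
  apply: (@le_lt_trans _ _ (leb `]0, 1]%classic)).
    apply: le_measure; rewrite ?inE//; apply: measurableI => //.
    by rewrite -[X in measurable X]setTI; exact: measurable_generalized_inverse.
  by rewrite lebesgue_measure_itv /= lte01 oppr0 adde0 ltry.
- exact: mB.
Qed.

End distribution_function.

(** * The induced system *)

Section induced_system.
Variables (R : realType) (n : nat) (t : 'I_n.+1 -> R) (c : 'I_n -> R).
Variables (S : R -> R) (mu : probability (measurableTypeR R) R).
Variables (X0 : set (measurableTypeR R)) (ustar : R).
Hypothesis S_itm : interval_translation_map t c S.
Hypothesis mu01 : mu `[0, 1[%classic = 1%E.
Hypothesis mu_nonatomic : nonatomic mu.
Hypothesis X0_core : invertible_core S mu X0.
Hypothesis ustar01 : 0 <= ustar <= 1.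

Local Notation h := (distr mu).
Local Notation leb := (@lebesgue_measure R).
Local Notation Q := (generalized_inverse mu).
Local Notation X := (good_points t S mu X0).
Local Notation Y := (good_values t S mu X0).
Local Notation T := (induced_map t S mu X0 ustar).
Local Notation Cdef := (defect_cut_set t c mu).
Local Notation lknot k := (t (widen_ord (leqnSn n) k)).
Local Notation rknot k := (t (lift ord0 k)).
Local Notation E0 := (exceptional_points t mu).

(** * The invertible core, exceptional points and good points *)

Lemma core_inj : {in X0 &, injective S}.
Proof. by have [_ [[]]] := X0_core. Qed.

Lemma core_stable (x : R) : X0 x -> X0 (S x).
Proof. by have [_ [[+ _ _] _ _ _]] := X0_core; exact. Qed.

Lemma measurable_core : measurable X0.
Proof. by have [[]] := X0_core. Qed.

Lemma core_itv (x : R) : X0 x -> supp mu x /\ 0 <= x < 1.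
Proof. by have [[_ + _] _] := X0_core => /[apply] -[] ? /=; rewrite in_itv. Qed.

Lemma countable_exceptional_points : countable E0.
Proof.
rewrite /exceptional_points -bigcup2inE; apply: bigcup_countable => //.
move=> [|[|//]] _ /=.
  apply: sub_countable (card_image_le _ _) _; exact: countableP.
have cV : countable [set V | is_component (`[0, 1] `\` supp mu) V].
  by apply: countable_components; exact: closed_supp.
pose F (b : bool) := (fun V : set R => if b then inf V else sup V) @`
  [set V | is_component (`[0, 1] `\` supp mu) V].
have sub : [set e | exists2 V, is_component (`[0, 1] `\` supp mu) V &
    e = inf V \/ e = sup V] `<=` \bigcup_b F b.
  move=> e [V VC [->|->]]; first by exists true => //; exists V.
  by exists false => //; exists V.
apply: sub_countable (subset_card_le sub) _.
apply: bigcup_countable => // b _.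
exact: sub_countable (card_image_le _ _) cV.
Qed.

Let countable_removed :
  countable (\bigcup_(m in [set: int]) (iterz S X0 m @` (E0 `&` X0))).
Proof.
apply: bigcup_countable => // m _.
apply: sub_countable (card_image_le _ _) _.
apply: sub_countable countable_exceptional_points.
by apply: subset_card_le => x [].
Qed.

Lemma probability_setD_countable (A B : set (measurableTypeR R)) :
  measurable A -> mu A = 1%E -> countable B ->
  measurable (A `\` B) /\ mu (A `\` B) = 1%E.
Proof.
move=> mA A1 /(nonatomic_countable _ _ mu_nonatomic)[mB B0].
split; first exact: measurableD.
rewrite setDE probability_setI1//; first exact: measurableC.
by rewrite probability_setC// B0 sube0.
Qed.

Lemma good_points_full : measurable X /\ mu X = 1%E.
Proof.
apply: probability_setD_countable => //; first exact: measurable_core.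
by have [[]] := X0_core.
Qed.

Lemma measurable_good_points : measurable X.
Proof. by have [] := good_points_full. Qed.

Lemma good_points_core (x : R) : X x -> X0 x.
Proof. by case. Qed.

Lemma good_points_not_exceptional (x : R) : X x -> ~ E0 x.
Proof.
by move=> [X0x nx] E0x; apply: nx; exists 0%R => //; exists x.
Qed.

(** If [S x] lies at time [m] on the orbit of an exceptional point, then [x] lies on it at time
    [m - 1]. *)
Lemma good_points_stable (x : R) : X x -> X (S x).
Proof.
move=> [X0x nx]; split; first exact: core_stable.
move=> [m _ [e [E0e X0e] em]]; apply: nx.
have xe : x = inverse_on X0 S (iterz S X0 m e).
  by rewrite em inverse_onK//; exact: core_inj.
(* The cases are [m = 0], [m > 0] and [m < 0]. Since [Negz p] is [-(p + 1)], the times [m - 1] are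
   [Negz 0], [Posz p] and [Negz p.+1]. *)
case: m em xe => [[|p]|p] _ /= xe.
- by exists (Negz 0) => //; exists e.
- exists (Posz p) => //; exists e => //=; rewrite xe inverse_onK//.
    exact: core_inj.
  by elim: p {xe} => //= p; exact: core_stable.
- by exists (Negz p.+1) => //; exists e.
Qed.

(** * Gaps of the support and the fibres of [h] *)

Let gap_not_supp (x y : R) : 0 <= x -> y <= 1 -> h x = h y ->
  `]x, y[ `<=` `[0, 1] `\` supp mu.
Proof.
move=> x0 y1 hxy z; rewrite /= !in_itv /= => /andP[xz zy]; split.
  by move: x0 y1 xz zy; lra.
have mu0 : mu (`]x, y[ `&` `[0, 1]) = 0%E.
  apply: (probability_eq0S _ _ _ `]x, y]%classic) => //.
  - exact: measurableI.
  - by move=> w [] /=; rewrite !in_itv /=; lra.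
  - by rewrite -distr_sub// ?hxy ?subrr//; move: xz zy; lra.
move=> [_ /(_ `]x, y[%classic)]; rewrite mu0 ltxx /= in_itv /= xz zy.
have oI : open (`]x, y[%classic : set R) by exact: interval_open.
by move=> /(_ oI isT).
Qed.

(** The component of the complement of the support that contains []x, y[] is an interval missing
    [x], so it lies to the right of [x] and its infimum is [x]. *)
Lemma gap_inf (x y : R) : supp mu x -> 0 <= x -> y <= 1 -> x < y ->
  h x = h y -> E0 x.
Proof.
move=> xJ x0 y1 xy hxy; have sub := gap_not_supp _ _ x0 y1 hxy.
pose z := (x + y) / 2; have zxy : `]x, y[%classic z.
  by rewrite /= in_itv /=; move: xy; rewrite /z; lra.
pose A := `[0, 1] `\` supp mu; pose V := connected_component A z.
have Vz : V z by apply: connected_component_refl; exact: sub.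
have VA : is_component A V by exists z => //; exact: sub.
have xyV : `]x, y[ `<=` V.
  apply: is_interval_connected_component => //; exact: interval_is_interval.
right; exists V => //; left.
have Vx v : V v -> x <= v.
  move=> Vv; rewrite leNgt; apply/negP => vx.
  have /(component_subset _ _ _ VA)[_] // : V x.
  apply: (component_is_interval _ _ _ VA v z) => //.
  by move: zxy; rewrite /= in_itv /= => /andP[/ltW -> _]; rewrite ltW.
apply/eqP; rewrite eq_le; apply/andP; split.
  by apply: lb_le_inf => //; exists z.
rewrite leNgt; apply/negP => xV.
(* The midpoint puts [w] strictly between [x] and [inf V], and the minimum with [z] keeps it below
   [y]; hence [w] is in [V] yet below its infimum. *)
pose w := Num.min ((x + inf V) / 2) z.
have Vw : V w.
  apply: xyV; rewrite /= in_itv /= /w lt_min gt_min.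
  move: zxy; rewrite /= in_itv /= => /andP[-> ->]; rewrite orbT !andbT.
  by move: xV; lra.
have : inf V <= w by apply: ge_inf => //; exists x.
by rewrite /w le_min => /andP[+ _]; move: xV; lra.
Qed.

(** Mirror image of [gap_inf]: the component now lies to the left of [y], with supremum [y]. *)
Lemma gap_sup (x y : R) : supp mu y -> 0 <= x -> y <= 1 -> x < y ->
  h x = h y -> E0 y.
Proof.
move=> yJ x0 y1 xy hxy; have sub := gap_not_supp _ _ x0 y1 hxy.
pose z := (x + y) / 2; have zxy : `]x, y[%classic z.
  by rewrite /= in_itv /=; move: xy; rewrite /z; lra.
pose A := `[0, 1] `\` supp mu; pose V := connected_component A z.
have Vz : V z by apply: connected_component_refl; exact: sub.
have VA : is_component A V by exists z => //; exact: sub.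
have xyV : `]x, y[ `<=` V.
  apply: is_interval_connected_component => //; exact: interval_is_interval.
right; exists V => //; right.
have Vy v : V v -> v <= y.
  move=> Vv; rewrite leNgt; apply/negP => yv.
  have /(component_subset _ _ _ VA)[_] // : V y.
  apply: (component_is_interval _ _ _ VA z v) => //.
  by move: zxy; rewrite /= in_itv /= => /andP[_ /ltW ->]; rewrite ltW.
apply/eqP; rewrite eq_le; apply/andP; split; last first.
  by apply: ge_sup => //; exists z.
rewrite leNgt; apply/negP => yV.
pose w := Num.max ((y + sup V) / 2) z.
have Vw : V w.
  apply: xyV; rewrite /= in_itv /= /w gt_max lt_max.
  move: zxy; rewrite /= in_itv /= => /andP[-> ->]; rewrite orbT !andbT /=.
  by move: yV; lra.
have : w <= sup V by apply: ub_le_sup => //; exists y.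
by rewrite /w ge_max => /andP[+ _]; move: yV; lra.
Qed.

(* Otherwise [x] would be an endpoint of a component of the complement of the
   support. *)
Lemma good_points_fiber (x y : R) : X x -> 0 <= y <= 1 -> h y = h x -> y = x.
Proof.
move=> Xx /andP[y0 y1] hyx; have nE := good_points_not_exceptional _ Xx.
have [Jx /andP[x0 /ltW x1]] := core_itv _ (good_points_core _ Xx).
have [yx|xy|//] := ltgtP y x; exfalso; apply: nE.
- exact: (gap_sup y x).
- exact: (gap_inf x y).
Qed.

(** * The coordinate [h] on the good points *)

Lemma distr_inj_good : {in X &, injective h}.
Proof.
move=> x y /set_mem Xx /set_mem Xy; apply: good_points_fiber => //.
by have [_ /andP[-> /ltW ->]] := core_itv _ (good_points_core _ Xx).
Qed.

Lemma generalized_inverse_good (x : R) : X x -> Q (h x) = x.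
Proof.
move=> Xx; apply: good_points_fiber => //; first exact: generalized_inverse_itv.
by rewrite distr_generalized_inverse// distr_ge0 distr_le1.
Qed.

(** By triviality of the fibres, height 0 would force [x = 0], which is a knot, and height 1 would
    force [x = 1], which is outside the core. *)
Lemma distr_good_itv (x : R) : X x -> 0 < h x < 1.
Proof.
move=> Xx; rewrite !lt_neqAle distr_ge0 distr_le1// !andbT.
have [_ x01] := core_itv _ (good_points_core _ Xx).
apply/andP; split; apply/eqP => hx.
  have x0 : 0 = x.
    by apply: good_points_fiber => //; [rewrite lexx ler01|rewrite -hx distr_le0].
  apply: (good_points_not_exceptional _ Xx); left; exists ord0 => //.
  by rewrite -x0; have [-> _ _ _] := S_itm.
have x1 : 1 = x.
  by apply: good_points_fiber => //; [rewrite lexx ler01|rewrite hx distr1].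
by move: x01; rewrite -x1 ltxx andbF.
Qed.

(** Direct images under [h] become preimages under the measurable map [Q]; this yields both their
    measurability and their Lebesgue measure. *)
Lemma image_distr_good (B : set R) : B `<=` X ->
  h @` B = `]0, 1] `&` Q @^-1` B.
Proof.
move=> BX; apply/seteqP; split=> [_ [x Bx <-]|u [/= u01 Bu]].
  have /andP[h0 /ltW h1] := distr_good_itv _ (BX _ Bx).
  split=> /=; first by rewrite in_itv /= h0 h1.
  by rewrite generalized_inverse_good//; exact: BX.
exists (Q u) => //; apply: distr_generalized_inverse => //.
by move: u01; rewrite in_itv /= => /andP[/ltW -> ->].
Qed.

Lemma quantileE (u : R) : Y u -> quantile t S mu X0 u = Q u.
Proof.
move=> [x Xx <-]; rewrite generalized_inverse_good// /quantile inverse_onK//.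
exact: distr_inj_good.
Qed.

Lemma measurable_image_good (B : set (measurableTypeR R)) :
  measurable B -> B `<=` X -> measurable (h @` B : set (measurableTypeR R)).
Proof.
move=> mB BX; rewrite image_distr_good//; apply: measurableI => //.
rewrite -[X in measurable X]setTI.
by apply: measurable_generalized_inverse.
Qed.

Lemma lebesgue_image_good (B : set (measurableTypeR R)) :
  measurable B -> B `<=` X -> leb (h @` B) = mu B.
Proof.
by move=> mB BX; rewrite image_distr_good// lebesgue_measure_generalized_inverse.
Qed.

Lemma measurable_good_values : measurable (Y : set (measurableTypeR R)).
Proof. by apply: measurable_image_good => //; exact: measurable_good_points. Qed.

Lemma lebesgue_good_valuesC : leb (`[0, 1] `\` Y) = 0%E.
Proof.
have [mX X1] := good_points_full.
apply/lebesgue_measure_unitC; first exact: measurable_good_values.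
- move=> _ [x Xx <-]; rewrite /= in_itv /=.
  by have /andP[/ltW -> /ltW ->] := distr_good_itv _ Xx.
- by rewrite lebesgue_image_good.
Qed.

Lemma induced_mapE (x : R) : X x -> T (h x) = h (S x).
Proof.
move=> Xx; have Yx : Y (h x) by exists x.
by rewrite /induced_map mem_set// quantileE// generalized_inverse_good.
Qed.

(** * Vanishing of the defect makes the induced map a translation *)

Let measurable_distr : measurable_fun setT (h : measurableTypeR R -> measurableTypeR R).
Proof. by apply: nondecreasing_measurable => //; exact: distr_nondecreasing. Qed.

(* [B + c k] contains [S (B `&` X0)], which has the measure of [B]. *)
Lemma defect_ge0 (k : 'I_n) (B : set (measurableTypeR R)) :
  measurable B -> B `<=` branch t k -> (mu B <= mu [set (x + c k)%R | x in B])%E.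
Proof.
move=> mB Bk; have [[mX0 _ X01] [[_ _ Ss] _ mi +]] := X0_core.
have mBX : measurable (B `&` X0) by exact: measurableI.
move=> /(_ (B `&` X0) mBX (@subIsetr _ _ _)) muE.
rewrite -(probability_setI1 _ _ B X0)// -muE; apply: le_measure; rewrite ?inE.
- exact: mi.
- exact: measurable_image_shift.
- move=> z [/Ss[y X0y <-]] /=; rewrite inverse_onK//; last exact: core_inj.
  move=> [By _]; exists y => //; have [_ _ _ H] := S_itm.
  by have [-> _] := H _ _ (Bk _ By).
Qed.

(** The defect is additive and nonnegative, so if it vanishes on [B] it vanishes on both [A] and the
    rest of [B]. *)
Lemma null_defect_subset (k : 'I_n) (A B : set (measurableTypeR R)) :
  measurable A -> measurable B -> A `<=` B -> B `<=` branch t k ->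
  (mu [set (x + c k)%R | x in B] <= mu B)%E -> mu [set (x + c k)%R | x in A] = mu A.
Proof.
move=> mA mB AB Bk; pose D := B `\` A.
have mD : measurable D by exact: measurableD.
have BE : B = A `|` D by rewrite setDUK.
have AD0 : A `&` D = set0 by rewrite /D setDE setICA setICr setI0.
have DD : mu B = (mu A + mu D)%E by rewrite {1}BE measureU.
have shE : mu [set (x + c k)%R | x in B] =
    (mu [set (x + c k)%R | x in A] + mu [set (x + c k)%R | x in D])%E.
  rewrite {1}BE image_setU measureU//; try exact: measurable_image_shift.
  rewrite !image_shift -preimage_setI AD0; exact: preimage_set0.
have HA := defect_ge0 _ _ mA (subset_trans AB Bk).
have HD : (mu D <= mu [set (x + c k)%R | x in D])%E.
  by apply: defect_ge0 mD _ => x [/Bk].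
rewrite shE DD; move: HA HD.
have fA := @fin_num_measure _ _ _ mu _ mA.
have fD := @fin_num_measure _ _ _ mu _ mD.
have fA' := @fin_num_measure _ _ _ mu _ (measurable_image_shift _ _ (c k) mA).
have fD' := @fin_num_measure _ _ _ mu _ (measurable_image_shift _ _ (c k) mD).
rewrite -(fineK fA) -(fineK fD) -(fineK fA') -(fineK fD') -!EFinD !lee_fin.
by move=> H1 H2 H3; congr EFin; move: H1 H2 H3; lra.
Qed.

(** Near [x] the heights stay in an open set without defect, so small intervals []z, w]] keep their
    measure when shifted by [c k]. In terms of [h], the increments over []z, w]] and over its shift
    agree. *)
Lemma distr_shift_locally_constant (k : 'I_n) (x : R) :
  lknot k < x < rknot k -> ~ supp (defect_distr t c mu k) (h x) ->
  \forall y \near x, h (y + c k) - h y = h (x + c k) - h x.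
Proof.
move=> /andP[kx xk] nsupp.
have [V [oV Vx V0]] : exists V : set R, [/\ open V, V (h x) &
    (defect_distr t c mu k (V `&` `[0%R, 1%R]) <= 0)%E].
  apply: contrapT => nV; apply: nsupp; split.
    by rewrite /= in_itv /= distr_ge0 distr_le1.
  move=> V oV Vx; rewrite ltNge; apply/negP => V0; apply: nV.
  by exists V.
have nV : \forall y \near x, V (h y).
  apply: (distr_continuous _ _ mu01 mu_nonatomic x).
  by apply: open_nbhs_nbhs; split.
have nk : \forall y \near x, lknot k < y < rknot k.
  have : x \in `]lknot k, rknot k[ by rewrite in_itv /= kx xk.
  by move=> /near_in_itvoo; apply: filterS => y; rewrite in_itv.
have : nbhs x [set y | V (h y) /\ lknot k < y < rknot k] by exact: filterI.
move=> /nbhs_ballP[e /= e0 xe].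
have key z w : z <= w -> ball x e z -> ball x e w ->
    h (z + c k) - h z = h (w + c k) - h w.
  move=> zw xz xw; have [_ zk] := xe _ xz; have [_ wk] := xe _ xw.
  pose B : set (measurableTypeR R) := h @^-1` (V `&` `[0, 1]) `&` branch t k.
  have mB : measurable B.
    apply: measurableI; last exact: measurable_itv.
    rewrite -[X in measurable X]setTI; apply: measurable_distr => //.
    by apply: measurableI => //; exact: open_measurable.
  have H : mu [set (x + c k)%R | x in `]z, w]%classic] = mu `]z, w]%classic.
    apply: (null_defect_subset k _ B) => //.
    - move=> y; rewrite /= in_itv /= => /andP[zy yw].
      have [|Vy ky] := xe y.
        by move: xz xw; rewrite /ball /= !ltr_norml; move: zy yw; lra.
      split; first by split=> //; rewrite /= in_itv /= distr_ge0 distr_le1.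
      by rewrite /branch /= in_itv /=; move: ky => /andP[/ltW -> ->].
    - by move=> y [].
    - move: V0; rewrite /defect_distr /defect -/B leeBlDr ?add0e//.
      by rewrite fin_num_measure.
  have : (h (w + c k) - h (z + c k))%:E = (h w - h z)%:E.
    rewrite !distr_sub ?lerD2r// -H image_shift; congr (mu _).
    by apply/seteqP; split=> y /=; rewrite !in_itv /=; lra.
  by case; lra.
apply/nbhs_ballP; exists e => //= y xy.
by have [yx|/ltW yx] := leP y x; [|apply/esym]; apply: key => //; exact: ballxx.
Qed.

(** A locally constant function has derivative zero, so the mean value theorem makes it constant on
    the segment. *)
Lemma distr_shift_constant (k : 'I_n) (x y : R) :
  lknot k < x -> x <= y -> y < rknot k ->
  (forall z, x <= z <= y -> ~ supp (defect_distr t c mu k) (h z)) ->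
  h (y + c k) - h y = h (x + c k) - h x.
Proof.
move=> kx xy yk nsupp; pose g (z : R) : R := h (z + c k) - h z.
have loc z : x <= z <= y -> \forall w \near z, g w = g z.
  move=> zxy; apply: distr_shift_locally_constant; last exact: nsupp.
  by move: kx yk zxy; lra.
have [|||z _ /eqP] := @MVT_segment R g (cst 0) x y => //.
- move=> z; rewrite in_itv /= => /andP[/ltW xz /ltW zy].
  apply: (@near_eq_is_derive _ _ _ (cst (g z))).
  have := loc z; rewrite xz zy => /(_ isT).
  by apply: filterS => w ->.
- apply: continuous_subspaceT => z.
  have hc := distr_continuous _ _ mu01 mu_nonatomic.
  apply: cvgB; last exact: hc.
  apply: (@continuous_comp _ _ _ (fun z => z + c k) h) => //; last exact: hc.
  by apply: cvgD => //; exact: cvg_cst.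
- by rewrite mul0r subr_eq0 => /eqP.
Qed.

(** A knot separating two good points with heights in [U] would, by monotonicity of [h], have its
    own height in the interval [U], which avoids the cut set. So a single branch [k] serves, and
    along it [h (x + c k) - h x] is constant. *)
Lemma induced_map_translation (U : set R) : is_interval U ->
  U `<=` `[0, 1] `\` Cdef -> U `&` Y !=set0 ->
  (exists k : 'I_n, quantile t S mu X0 @` (U `&` Y) `<=` branch t k) /\
  (exists d : R, forall u, (U `&` Y) u -> T u = u + d).
Proof.
move=> iU UC [u0 [Uu0 [x0 Xx0 hx0]]]; have Ux0 : U (h x0) by rewrite hx0.
have [t0 t1 _ SE] := S_itm.
have Xitv x : X x -> t ord0 <= x < t ord_max.
  move=> Xx; rewrite t0 t1.
  by have [] := core_itv _ (good_points_core _ Xx).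
have [k kx0] := branch_exists _ _ _ _ (Xitv _ Xx0).
have nknot i : ~ U (h (t i)).
  by move=> /UC[_]; apply; left; exists (t i) => //; exists i.
have in_k x : X x -> U (h x) -> lknot k < x < rknot k.
  move=> Xx Ux; move: kx0; rewrite /branch /= in_itv /= => /andP[kx0 x0k].
  apply/andP; split; rewrite ltNge; apply/negP => xk.
    apply: (nknot (widen_ord (leqnSn n) k)).
    by apply: (iU (h x) (h x0)) => //; rewrite !(distr_nondecreasing _ _).
  apply: (nknot (lift ord0 k)).
  by apply: (iU (h x0) (h x)) => //; rewrite !(distr_nondecreasing _ _)// ltW.
have nsupp x : U (h x) -> ~ supp (defect_distr t c mu k) (h x).
  by move=> /UC[_ nC] Sx; apply: nC; right; exists k.
have g_le x y : X x -> X y -> U (h x) -> U (h y) -> x <= y ->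
    h (y + c k) - h y = h (x + c k) - h x.
  move=> Xx Xy Ux Uy xy; have /andP[kx _] := in_k _ Xx Ux.
  have /andP[_ yk] := in_k _ Xy Uy; apply: distr_shift_constant => // z /andP[xz zy].
  by apply: nsupp; apply: (iU (h x) (h y)) => //; rewrite !distr_nondecreasing.
have sub x : X x -> U (h x) -> branch t k x.
  by move=> Xx Ux; rewrite /branch /= in_itv /=; have /andP[/ltW -> ->] := in_k _ Xx Ux.
split.
  exists k => _ [u [Uu [x Xx hx]] <-]; have Ux : U (h x) by rewrite hx.
  rewrite -{u Uu}hx.
  have Yx : Y (h x) by exists x.
  rewrite quantileE// generalized_inverse_good//.
  exact: sub.
(* The constant is read off at the reference point [x0]; for the other points,
   [T (h x) = h (x + c k)]. *)
exists (h (x0 + c k) - h x0) => u [Uu [x Xx hx]]; have Ux : U (h x) by rewrite hx.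
rewrite -{u Uu}hx induced_mapE//; have [-> _] := SE _ _ (sub _ Xx Ux).
have <- : h (x + c k) - h x = h (x0 + c k) - h x0; last by ring.
by have [xx0|/ltW xx0] := leP x x0; [apply/esym|]; exact: g_le.
Qed.

(** * Injectivity of the induced map and disjointness of the translated pieces *)

Lemma induced_map_itv (u : R) : 0 <= T u <= 1.
Proof.
by rewrite /induced_map; case: ifP => // _; rewrite distr_ge0 distr_le1.
Qed.

Lemma induced_map_inj : {in Y &, injective T}.
Proof.
move=> _ _ /set_mem[x Xx <-] /set_mem[y Xy <-].
have SX z : X z -> X (S z) by exact: good_points_stable.
rewrite !induced_mapE// => /(distr_inj_good).
rewrite !inE => /(_ (SX _ Xx) (SX _ Xy)).
by move=> /(core_inj); rewrite !inE => -> //; exact: good_points_core.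
Qed.

(** Both [Y] and its translate by [- e] are conull in []a, b[], which has positive length, so they
    meet there. *)
Lemma good_values_shift_dense (a b e : R) : a < b -> 0 <= a -> b <= 1 ->
  0 <= a + e -> b + e <= 1 -> exists y, [/\ a < y < b, Y y & Y (y + e)].
Proof.
move=> ab a0 b1 ae0 be1; apply: contrapT => nY.
pose N : set (measurableTypeR R) := `[0, 1] `\` Y.
have mN : measurable N.
  by apply: measurableD => //; exact: measurable_good_values.
have N0 : leb N = 0%E by exact: lebesgue_good_valuesC.
have mNe : measurable ([set x | N (x + e)] : set (measurableTypeR R)).
  have := measurable_image_shift _ _ (- e) mN.
  by rewrite image_shift; congr measurable; apply/seteqP; split=> x /=; rewrite opprK.
have : leb.-negligible (`]a, b[%classic : set (measurableTypeR R)).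
  apply: (@negligibleS _ _ _ _ (N `|` [set x | N (x + e)])).
    move=> x; rewrite /= in_itv /= => xab; apply: contrapT => /not_orP[nN nNe].
    apply: nY; exists x; split=> //; apply: contrapT => nYx.
      by apply: nN; split=> //; rewrite /= in_itv /=; move: xab a0 b1; lra.
    by apply: nNe; split=> //; rewrite /= in_itv /=; move: xab ae0 be1; lra.
  apply: negligibleU; apply/negligibleP => //.
  by rewrite [LHS]lebesgue_measure_shift.
move=> /negligibleP => /(_ (measurable_itv _)) ab0.
have : leb `]a, b[%classic = 0%E by exact: ab0.
rewrite lebesgue_measure_itv /= lte_fin ab -EFinD => -[]; move: ab; lra.
Qed.

Lemma good_values_dense (a b : R) : a < b -> 0 <= a -> b <= 1 ->
  exists2 y, a < y < b & Y y.
Proof.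
move=> ab a0 b1; have := good_values_shift_dense a b 0 ab a0 b1.
by rewrite !addr0 => /(_ a0 b1)[y [yab Yy _]]; exists y.
Qed.

(** Translation formulas hold only on [Y], to which [u] and [v] need not belong. A nearby [y] with
    [y] and [y + e] both in [Y] satisfies [T y = T (y + e)], and injectivity of [T] on [Y] gives
    [e = 0]. *)
Lemma translates_inj (a b d a' b' d' u v : R) :
  0 <= a -> b <= 1 -> 0 <= a' -> b' <= 1 ->
  (forall y, a < y < b -> Y y -> T y = y + d) ->
  (forall y, a' < y < b' -> Y y -> T y = y + d') ->
  a < u < b -> a' < v < b' -> u + d = v + d' -> u = v.
Proof.
move=> a0 b1 a'0 b'1 Td Td' uab vab uv; pose e := d - d'.
have [|||||y [yab Yy Yye]] :=
  (* This interval collects the [y] in []a, b[] with [y + e] in []a', b'[]; it is nonempty because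
     it contains [u], as [u + e = v]. *)
  @good_values_shift_dense (Num.max a (a' - e)) (Num.min b (b' - e)) e.
- by rewrite lt_min !gt_max /e; move: uab vab uv; lra.
- by rewrite le_max a0.
- by rewrite ge_min b1.
- by rewrite -lerBlDr sub0r le_max /e; apply/orP; right; move: a'0; lra.
- by rewrite -lerBrDr ge_min; apply/orP; right; move: b'1; lra.
move: yab; rewrite gt_max lt_min => /andP[/andP[ay a'y] /andP[yb yb']].
have : T y = T (y + e).
  rewrite Td ?ay// Td'//; first by rewrite /e; lra.
  by move: a'y yb'; rewrite /e; lra.
move=> /induced_map_inj; rewrite !inE => /(_ Yy Yye); rewrite /e; move: uv; lra.
Qed.

(** Otherwise some value in [Y] near an end of the interval would be sent outside [0, 1]. *)
Lemma translate_itv (a b d : R) : a < b -> 0 <= a -> b <= 1 ->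
  (forall y, a < y < b -> Y y -> T y = y + d) -> 0 <= a + d /\ b + d <= 1.
Proof.
move=> ab a0 b1 Td; split; rewrite leNgt; apply/negP => H.
- have [|||y] := good_values_dense a (Num.min b (- d)); first 3 last.
  + rewrite lt_min => /and3P[ay yb yd] Yy; have := induced_map_itv y.
    by rewrite Td ?ay// => /andP[+ _]; move: yd; lra.
  + by rewrite lt_min ab; move: H; lra.
  + exact: a0.
  + by rewrite ge_min b1.
- have [|||y] := good_values_dense (Num.max a (1 - d)) b; first 3 last.
  + rewrite gt_max => /andP[/andP[ay yd] yb] Yy; have := induced_map_itv y.
    by rewrite Td ?ay// => /andP[_]; move: yd; lra.
  + by rewrite gt_max ab; move: H; lra.
  + by rewrite le_max a0.
  + exact: b1.
Qed.

(** The isomorphism is [h] restricted to [X']. Leaving [X'] and [F] free allows a further null set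
    to be discarded when [F] agrees with [T] only off the cut points. *)
Lemma good_points_equivalence (X' B : set (measurableTypeR R)) (F : R -> R) :
  measurable X' -> X' `<=` X -> mu X' = 1%E -> set_fun X' X' S ->
  measurable B -> B `<=` `[0, 1] -> h @` X' `<=` B ->
  (forall x, X' x -> F (h x) = h (S x)) ->
  metrically_equivalent (supp mu `&` `[0, 1[%classic) mu S B leb F.
Proof.
move=> mX' X'X X'1 X'S mB B01 hB FE.
have hI : {in X' &, injective h}.
  move=> x y /set_mem X'x /set_mem X'y.
  by apply: (distr_inj_good);
    rewrite inE; exact: X'X.
have mY' : measurable (h @` X' : set (measurableTypeR R)).
  exact: measurable_image_good.
have lY' E : measurable E -> E `<=` X' -> leb (h @` E) = mu E.
  move=> mE EX'; apply: lebesgue_image_good => //.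
  exact: subset_trans X'X.
exists X', (h @` X'), h; split.
- split=> //.
  + move=> x X'x; have X0x := good_points_core _ (X'X _ X'x).
    by have [Jx x01] := core_itv _ X0x; split=> //=; rewrite in_itv.
  + apply: (probability_eq0S _ _ _ (~` X')).
    * apply: measurableD => //; apply: measurableI => //.
      by apply: closed_measurable; exact: closed_supp.
    * exact: measurableC.
    * by move=> x [].
    * by rewrite probability_setC// X'1 subee.
- split=> //.
  + apply/eqP; rewrite -measure_le0.
    apply: (@le_trans _ _ (leb (`[0, 1] `\` h @` X'))).
      apply: le_measure; rewrite ?inE; try exact: measurableD.
      by apply: setSD.
    rewrite (iffRL (lebesgue_measure_unitC _ _ mY' _))//; first exact: subset_trans B01.
    by rewrite lY'.
  + by move=> _ [x X'x <-]; exists (S x); [exact: X'S|rewrite FE].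
- split.
  + by split=> // x X'x; exists x.
  + exact: measurable_funS measurable_distr.
  (* The inverse of [h] on the image of [X'] is a restriction of the monotone map [Q]. *)
  + apply: (eq_measurable_fun Q) => [u /set_mem[x X'x <-]|].
      rewrite inverse_onK//; apply: generalized_inverse_good _ _.
      exact: X'X.
    apply: measurable_funS (measurable_generalized_inverse _ _ mu01) => //.
- move=> E mE EY'; rewrite -lY'//.
  + congr leb; apply/seteqP; split=> [_ [x [_ Ex] <-]//|u Eu].
    by have [x X'x xu] := EY' _ Eu; exists x => //; split=> //=; rewrite xu.
  + apply: measurableI => //; rewrite -[X in measurable X]setTI.
    exact: measurable_distr.
- by move=> x X'x; rewrite FE.
Qed.

Lemma induced_map_translation_ae (U : set R) (d : R) : U `<=` `[0, 1] ->
  (forall u, (U `&` Y) u -> T u = u + d) ->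
  {ae leb, forall u, U u -> T u = u + d}.
Proof.
move=> U01 Td.
apply: (@negligibleS _ _ _ _ (`[0, 1] `\` Y : set (measurableTypeR R))).
  move=> u /= /not_implyP[Uu Tu]; split; first exact: U01.
  by move=> Yu; apply: Tu; apply: Td.
apply/negligibleP; last exact: lebesgue_good_valuesC.
by apply: measurableD => //; exact: measurable_good_values.
Qed.

(** * The cut set and the open intervals avoiding it *)

Lemma defect_cut_set_itv : Cdef `<=` `[0, 1].
Proof.
move=> u [[x _ <-]|[k _ []//]].
by rewrite /= in_itv /= distr_ge0 distr_le1.
Qed.

Lemma defect_cut_set0 : Cdef 0.
Proof.
have [t0 _ _ _] := S_itm; left; exists (t ord0); first by exists ord0.
by rewrite t0 distr_le0.
Qed.

Lemma defect_cut_set1 : Cdef 1.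
Proof.
have [_ t1 _ _] := S_itm; left; exists (t ord_max); first by exists ord_max.
by rewrite t1 distr1.
Qed.

Lemma closed_defect_cut_set : closed Cdef.
Proof.
apply: closedU.
  have /accessible_finite_set_closed := hausdorff_accessible (@Rhausdorff R).
  apply; do 2 apply: finite_image; exact: finite_finset.
apply: closed_bigcup; first exact: finite_finset.
by move=> k _; exact: closed_supp.
Qed.

(** The points 0 and 1 are cut points, so the interval cannot reach across them; density of [Y]
    supplies the good value needed to apply [induced_map_translation]. *)
Lemma open_itv_translation (a b : R) : a < b ->
  `]a, b[ `<=` `[0, 1] `\` Cdef ->
  [/\ 0 <= a, b <= 1 & exists d, forall y, a < y < b -> Y y -> T y = y + d].
Proof.
move=> ab abC; have ab01 u : a < u < b -> 0 < u < 1.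
  move=> uab; have [|u01 nCu] := abC u; first by rewrite /= in_itv.
  move: u01; rewrite /= in_itv /= !lt_neqAle => /andP[-> ->]; rewrite !andbT.
  apply/andP; split; apply/eqP => uE; apply: nCu.
    by rewrite -uE; exact: defect_cut_set0.
  by rewrite uE; exact: defect_cut_set1.
have a0 : 0 <= a.
  rewrite leNgt; apply/negP => a0; have [b0|b0] := leP b 0.
    by have := ab01 ((a + b) / 2); move: ab a0 b0; lra.
  by have := ab01 0; rewrite a0 b0 ltxx => /(_ isT).
have b1 : b <= 1.
  rewrite leNgt; apply/negP => b1; have [a1|a1] := leP 1 a.
    by have := ab01 ((a + b) / 2); move: ab a1 b1; lra.
  by have := ab01 1; rewrite a1 b1 ltxx andbF => /(_ isT).
split=> //; have [y yab Yy] := good_values_dense a b ab a0 b1.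
have [|_ [d Td]] := induced_map_translation _ (@interval_is_interval R `]a, b[) abC.
  by exists y; split=> //=; rewrite in_itv.
by exists d => z zab Yz; apply: Td; split=> //=; rewrite in_itv.
Qed.

(** * The countable interval exchange *)

Lemma measurable_induced_map :
  measurable_fun (`[0, 1]%classic : set (measurableTypeR R))
    (T : measurableTypeR R -> measurableTypeR R).
Proof.
have mY := measurable_good_values.
have -> : `[0, 1]%classic = Y `|` (`[0, 1] `\` Y).
  rewrite setDUK// => _ [x Xx <-]; rewrite /= in_itv /=.
  by have /andP[/ltW -> /ltW ->] := distr_good_itv _ Xx.
apply/measurable_funU => //; first exact: measurableD.
split.
- apply: (eq_measurable_fun (h \o (S \o Q))) => [u /set_mem[x Xx <-]|].
    by rewrite /= generalized_inverse_good// induced_mapE.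
  apply: (measurable_comp (F := setT)) => //.
  (* Measurability of [S] is given only on [X0], into which [Q] maps [Y]. *)
  apply: (measurable_comp (F := X0)) => //.
  + exact: measurable_core.
  + by move=> _ [u [x Xx <-] <-]; rewrite generalized_inverse_good//; case: Xx.
  + by have [_ []] := X0_core.
  + exact: measurable_funS (measurable_generalized_inverse _ _ mu01).
- apply: (eq_measurable_fun (cst ustar)) => [u /set_mem[_ nYu]|].
    by rewrite /= /induced_map memNset.
  exact: measurable_cst.
Qed.

(** The pieces are disjoint open intervals filling []0, 1[] minus the cut set. Their translates are
    disjoint by [translates_inj] and have the same total length 1, hence cover [0, 1] up to a null
    set. *)
Lemma countable_iet_induced_map : leb Cdef = 0%E -> countable_iet T.
Proof.
move=> C0; pose O : set R := `]0, 1[ `\` Cdef.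
have oO : open O.
  by apply: openI; [exact: interval_open|rewrite openC; exact: closed_defect_cut_set].
pose I := open_disjoint_itv oO.
have OE : O = \bigcup_q I q by exact: open_disjoint_itv_bigcup.
have IO m : I m `<=` O by move=> x Ix; rewrite OE; exists m.
pose a m := inf (I m); pose b m := sup (I m).
have IE m : I m = `]a m, b m[%classic.
  have oI : open (I m) by exact: open_disjoint_itv_open.
  rewrite -[LHS](iffLR (interior_id _) oI).
  rewrite interval_bounded_interior.
  - by apply/seteqP; split=> x /=; rewrite in_itv.
  - exact: open_disjoint_itv_is_interval.
  - by exists 0 => x /IO[] /=; rewrite in_itv /= => /andP[/ltW].
  - by exists 1 => x /IO[] /=; rewrite in_itv /= => /andP[_ /ltW].
have OC : O `<=` `[0, 1] `\` Cdef.
  by move=> x [/=]; rewrite !in_itv /= => /andP[/ltW -> /ltW ->].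
(* Terms of the enumeration may be empty; [D] keeps the genuine intervals. *)
pose D : set nat := [set m | I m !=set0].
have ab m : D m -> a m < b m.
  by move=> [x]; rewrite IE /= in_itv /= => /andP[]; exact: lt_trans.
have IC m : `]a m, b m[ `<=` `[0, 1] `\` Cdef.
  by rewrite -IE; apply: subset_trans OC; exact: IO.
have transl m : exists d, D m -> [/\ 0 <= a m, b m <= 1,
    0 <= a m + d, b m + d <= 1 &
    forall y, a m < y < b m -> Y y -> T y = y + d].
  have [Dm|nDm] := pselect (D m); last by exists 0 => /nDm.
  have [a0 b1 [d Td]] := open_itv_translation _ _ (ab _ Dm) (IC m).
  have [ad bd] := translate_itv _ _ _ (ab _ Dm) a0 b1 Td.
  by exists d.
have [d Td] := choice transl.
have tI : trivIset D I.
  by move=> i j _ _; apply: open_disjoint_itv_trivIset.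
have UDE : \bigcup_(m in D) I m = O.
  rewrite OE; apply/seteqP; split=> x [m _ Ix].
    by exists m.
  by exists m => //; exists x.
have mI m : measurable (`]a m, b m[%classic : set (measurableTypeR R)).
  exact: measurable_itv.
have mV m : measurable (`]a m + d m, b m + d m[%classic : set (measurableTypeR R)).
  exact: measurable_itv.
have mO : measurable (O : set (measurableTypeR R)) by exact: open_measurable.
have O1 : leb O = 1%E.
  apply/lebesgue_measure_unitC => //; first by apply: subset_trans OC _ => x [].
  rewrite -C0; congr leb; apply/seteqP; split=> x.
    move=> [x01 nOx]; apply: contrapT => nCx; apply: nOx; split=> //.
    move: x01; rewrite /= !in_itv /= !lt_neqAle => /andP[-> ->]; rewrite !andbT.
    apply/andP; split; apply/eqP => xE; apply: nCx.
      by rewrite -xE; exact: defect_cut_set0.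
    by rewrite xE; exact: defect_cut_set1.
  by move=> Cx; split; [exact: defect_cut_set_itv|case].
have tV : trivIset D (fun m => `]a m + d m, b m + d m[%classic).
  move=> i j Di Dj [w []]; rewrite /= !in_itv /= => wi wj.
  have [ai bi _ _ Ti] := Td _ Di; have [aj bj _ _ Tj] := Td _ Dj.
  (* A common point [w] of two translates comes from one and the same point, which would lie in both
     original intervals. *)
  have E : w - d i = w - d j.
    apply: (translates_inj (a i) (b i) (d i) (a j) (b j) (d j)) => //;
      [move: wi|move: wj|]; lra.
  apply: (tI _ _ Di Dj); exists (w - d i); split.
    by rewrite IE /= in_itv /=; move: wi; lra.
  by rewrite IE /= in_itv /= E; move: wj; lra.
split.
- exact: measurable_induced_map.
- by move=> u _; rewrite /= in_itv /= induced_map_itv.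
exists D, a, b, d => U V; have UI : U = I by apply/funext => m; rewrite IE.
have UDO : \bigcup_(m in D) U m = O by rewrite UI.
split; split.
- move=> m Dm; split; first exact: ab.
  by move=> x /IC[].
- by rewrite UI.
- rewrite UDO; apply/lebesgue_measure_unitC => //.
  by apply: subset_trans OC _ => x [].
- move=> m /Td[_ _ _ _ Tm]; apply: induced_map_translation_ae.
    by move=> x /IC[].
  by move=> u []; rewrite /U /= in_itv /=; exact: Tm.
- move=> m /Td[_ _ ad bd _] x; rewrite /V /= !in_itv /=; move: ad bd; lra.
- exact: tV.
- apply/lebesgue_measure_unitC.
  + apply: bigcup_measurable => m _; exact: mV.
  + move=> x [m /Td[_ _ ad bd _]]; rewrite /V /= !in_itv /=; move: ad bd; lra.
  rewrite -O1 -UDO [LHS]measure_bigcup//; last by move=> m _; exact: mV.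
  rewrite [RHS]measure_bigcup//; first last.
  + by rewrite UI.
  + by move=> m _; exact: mI.
  apply: eq_eseriesr => m _; rewrite [LHS]lebesgue_measure_itv.
  rewrite [RHS]lebesgue_measure_itv /= !lte_fin ltrD2r; case: ifP => // _.
  by rewrite -!EFinB; congr EFin; ring.
Qed.

Lemma countable_equivalence :
  metrically_equivalent (supp mu `&` `[0, 1[%classic) mu S `[0, 1]%classic leb T.
Proof.
apply: (good_points_equivalence X) => //.
- exact: measurable_good_points.
- by have [] := good_points_full.
- exact: good_points_stable.
- move=> _ [x Xx <-]; rewrite /= in_itv /=.
  by have /andP[/ltW -> /ltW ->] := distr_good_itv _ Xx.
- exact: induced_mapE.
Qed.

(** * The finite interval exchange *)

Lemma finite_equivalence : finite_set Cdef ->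
  exists F : R -> R, finite_iet F /\
    metrically_equivalent (supp mu `&` `[0, 1[%classic) mu S `[0, 1[%classic leb F.
Proof.
move=> finC; have [m [s [s0 s1 s_incr sC]]] := finite_subdivision _ _ finC
  defect_cut_set_itv defect_cut_set0 defect_cut_set1.
pose a (k : 'I_m) := s (widen_ord (leqnSn m) k).
pose b (k : 'I_m) := s (lift ord0 k).
have kC (k : 'I_m) : `]a k, b k[ `<=` `[0, 1] `\` Cdef.
  move=> u; rewrite /= in_itv /= => ukb; split; last first.
    by rewrite -sC; exact: open_branch_knots ukb.
  have C01 i : 0 <= s i <= 1.
    have /defect_cut_set_itv : Cdef (s i) by rewrite -sC; exists i.
    by rewrite /= in_itv.
  have := C01 (widen_ord (leqnSn m) k); have := C01 (lift ord0 k).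
  by rewrite /= in_itv /=; move: ukb; rewrite /a /b; lra.
have transl k : exists d, [/\ 0 <= a k, b k <= 1, 0 <= a k + d, b k + d <= 1 &
    forall y, a k < y < b k -> Y y -> T y = y + d].
  have [a0 b1 [d Td]] := open_itv_translation _ _ (s_incr k) (kC k).
  have [ad bd] := translate_itv _ _ _ (s_incr k) a0 b1 Td.
  by exists d.
have [d Td] := choice transl.
(* The translations are extended to whole half-open branches, including left endpoints, where [T]
   may differ. Uniqueness of the branch makes this consistent; off all branches 0 is a
   placeholder. *)
have Fex u : exists w, forall k, branch s k u -> w = u + d k.
  have [[k ku]|nu] := pselect (exists k, branch s k u); last first.
    by exists 0 => k ku; exfalso; apply: nu; exists k.
  by exists (u + d k) => l lu; rewrite (branch_uniq _ _ _ s_incr _ _ _ ku lu).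
have [F FE] := choice Fex.
have openk u : 0 <= u < 1 -> ~ range s u -> exists2 k, branch s k u & a k < u < b k.
  rewrite -s0 -s1 => /(branch_exists _ _ s)[k ku] nsu; exists k => //.
  move: (ku); rewrite /branch /= in_itv /= => /andP[ka ->].
  rewrite andbT lt_neqAle ka andbT; apply/eqP => au; apply: nsu.
  by exists (widen_ord (leqnSn m) k).
exists F; split.
  exists m, s, d; split.
    split=> // k x kx; split; first exact: FE.
    have [_ _ ad bd _] := Td k; move: kx ad bd.
    by rewrite /branch /= in_itv /= -/(a k) -/(b k); lra.
  move=> u v /set_mem[+ nu] /set_mem[+ nv]; rewrite /= !in_itv /= => u01 v01.
  have [k ku ku'] := openk _ u01 nu; have [l lv lv'] := openk _ v01 nv.
  rewrite (FE _ _ ku) (FE _ _ lv).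
  have [ak bk _ _ Tk] := Td k; have [al bl _ _ Tl] := Td l.
  exact: (translates_inj (a k) (b k) (d k) (a l) (b l) (d l)).
(* [B] gathers the points [Q u] over cut points [u], with all their iterates under the inverse of
   [S]. It is countable, and for good [x], [S x] in [B] forces [x] in [B], so the good points off
   [B] are stable under [S]. *)
pose B : set (measurableTypeR R) :=
  \bigcup_(p in [set: nat]) (iter p (inverse_on X0 S) @` (Q @` Cdef)).
have cB : countable B.
  apply: bigcup_countable => // p _; do 2 apply: sub_countable (card_image_le _ _) _.
  exact: finite_set_countable.
have [mXB XB1] := probability_setD_countable _ _ measurable_good_points
  good_points_full.2 cB.
have hx01 x : X x -> `[0, 1[%classic (h x).
  by move=> Xx; rewrite /= in_itv /=; have /andP[/ltW -> ->] := distr_good_itv _ Xx.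
apply: (good_points_equivalence (X `\` B)) => //.
- move=> x [Xx nBx]; split; first exact: good_points_stable.
  move=> [p _ [w Cw Sx]]; apply: nBx; exists p.+1 => //; exists w => //=.
  by rewrite Sx inverse_onK//; [exact: core_inj|exact: good_points_core].
- by move=> x; rewrite /= !in_itv /= => /andP[-> /ltW ->].
- by move=> _ [x [Xx _] <-]; exact: hx01.
(* Off [B] the height of [x] is not a cut point, so it lies inside an open branch, where [F] and [T]
   agree. *)
- move=> x [Xx nBx]; have nsh : ~ range s (h x).
    rewrite sC => Chx; apply: nBx; exists 0%N => //; exists x => //.
    by exists (h x) => //; exact: generalized_inverse_good.
  have := hx01 _ Xx; rewrite /= in_itv => /openk /(_ nsh)[k kx kx'].
  have [_ _ _ _ Tk] := Td k.
  by rewrite (FE _ _ kx) -Tk ?induced_mapE//; exists x.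
Qed.

End induced_system.

Theorem theorem7p3 (R : realType) (n : nat) (t : 'I_n.+1 -> R) (c : 'I_n -> R)
    (S : R -> R) (mu : probability (measurableTypeR R) R)
    (X0 : set (measurableTypeR R)) (ustar : R)
    (S_itm : interval_translation_map t c S)
    (mu01 : mu `[0, 1[%classic = 1%E)
    (mu_nonatomic : nonatomic mu)
    (mu_inv : invariant_measure S mu)
    (X0_core : invertible_core S mu X0)
    (ustar01 : 0 <= ustar <= 1) :
  let J := supp mu in
  let Y := good_values t S mu X0 in
  let q := quantile t S mu X0 in
  let T := induced_map t S mu X0 ustar in
  let Cdef := defect_cut_set t c mu in
  [/\ (forall U : set R, is_component (`[0, 1] `\` Cdef) U ->
         (U `&` Y !=set0 ->
            (exists k : 'I_n, q @` (U `&` Y) `<=` branch t k) /\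
            (exists dU : R, forall u, (U `&` Y) u -> T u = u + dU)) /\
         (exists dU : R,
            {ae lebesgue_measure, forall u, U u -> T u = u + dU})),
      (finite_set Cdef ->
         exists F : R -> R, finite_iet F /\
           metrically_equivalent (J `&` `[0, 1[%classic) mu S
             `[0, 1[%classic lebesgue_measure F) &
      (lebesgue_measure Cdef = 0%E ->
         exists F : R -> R, countable_iet F /\
           metrically_equivalent (J `&` `[0, 1[%classic) mu S
             `[0, 1]%classic lebesgue_measure F)].
Proof.
move=> J Y q T Cdef; split.
- move=> U CU; have iU := component_is_interval _ _ _ CU.
  have UC : U `<=` `[0, 1] `\` Cdef by exact: component_subset CU.
  have UY := induced_map_translation _ _ _ _ _ _ _ ustar S_itm mu01 mu_nonatomic
    X0_core _ iU UC.
  have U01 : U `<=` `[0, 1] by move=> u /UC[].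
  have Tae d := induced_map_translation_ae _ _ _ _ _ _ _ ustar S_itm mu01
    mu_nonatomic X0_core U d U01.
  split=> //; have [/UY[_ [d Td]]|UY0] := pselect (U `&` Y !=set0).
    by exists d; exact: Tae.
  (* Here [U] misses the conull set [Y], so it is null and any constant serves. *)
  by exists 0; apply: Tae => u UYu; exfalso; apply: UY0; exists u.
- by apply: (finite_equivalence _ _ _ _ _ _ X0 ustar).
- move=> C0; exists T; split; first exact: (countable_iet_induced_map _ _ t c).
  exact: (countable_equivalence _ _ t c).
Qed.
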